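(* Let $\mu$ be any probability measure on $\mathbb{R}$ with finite moments, let $x^*\in \mathbb{R}$, $\alpha\geq 0$, and assume that $f:\mathbb{R}\to\mathbb{R}$ satisfies $$|f(x)-f(y)|\leq |f|_{\mathcal L}\, |x-y| \qquad (x,y\in\mathbb{R})$$ for some constant $|f|_{\mathcal L} \geq 0$. Then for every $n\in\mathbb{N}$ $$\operatorname{Var} X_{f,\alpha,x^*} ^{(n)}\leq|f|_{\mathcal L}^2 \left(\frac{\gamma_{n-1}}{\gamma_n} \right)^2 n^{2\alpha}.$$ In particular, if $\mu$ has compact support, then $\operatorname{Var} X_f^{(n)}$ is bounded (in $n$).
   Context: $\mu$ is assumed to have infinite support. $p_j(x)=\gamma_jx^j+\dots$, $\gamma_j>0$, are the orthonormal polynomials of $\mu$, with leading coefficients $\gamma_j$. The orthogonal polynomial ensemble (OPE) of size $n$ associated with $\mu$ is the probability measure $\frac{1}{Z_n}\prod_{i>j}(\lambda_i-\lambda_j)^2\,d\mu(\lambda_1)\cdots d\mu(\lambda_n)$ on $\mathbb{R}^n$, with $Z_n$ a normalizing constant. $X_f^{(n)}=\sum_{j=1}^n f(\lambda_j)$ and $X_{f,\alpha,x^*}^{(n)}=\sum_{j=1}^n f(n^\alpha(\lambda_j-x^* ))$ with $(\lambda_1,\dots,\lambda_n)$ random from the OPE, and $\operatorname{Var}$ is the variance with respect to it. *)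

(* Defs.v *)
From HB Require Import structures.
From mathcomp Require Import all_boot all_order all_algebra.
From mathcomp Require Import all_classical all_reals all_analysis.
From mathcomp Require Import measurable_realfun.

Set Implicit Arguments.
Unset Strict Implicit.
Unset Printing Implicit Defensive.

Import Order.TTheory GRing.Theory Num.Theory.
Import numFieldNormedType.Exports.

Local Open Scope classical_set_scope.
Local Open Scope ring_scope.

Section product_probability.
Local Open Scope ereal_scope.
Context d1 d2 (T1 : measurableType d1) (T2 : measurableType d2) (R : realType).
Variables (P1 : probability T1 R) (P2 : probability T2 R).

Let prod := P1 \x P2.

HB.instance Definition _ := Measure.on prod.

Let prod_setT : prod setT = 1.
Proof.
rewrite /prod -setXTT [LHS]product_measure1E//.
by rewrite -[RHS]mule1; congr (_ * _); exact: probability_setT.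
Qed.

HB.instance Definition _ := Measure_isProbability.Build _ _ _ prod prod_setT.

Definition product_probability : probability (T1 * T2)%type R := prod.

End product_probability.

Section power_probability.
Context d (T : measurableType d) (R : realType).

Definition cons_pair n (x : T * n.-tuple T) : n.+1.-tuple T :=
  [tuple of x.1 :: x.2].

Let measurable_cons_pair n : measurable_fun setT (@cons_pair n).
Proof. exact: measurable_cons. Qed.

HB.instance Definition _ n :=
  isMeasurableFun.Build _ _ _ _ (@cons_pair n) (@measurable_cons_pair n).

Variable P : probability T R.

(* The product measure P^n on n-tuples; power_probability_box below is its
   characteristic property. *)
Fixpoint power_probability n : probability (n.-tuple T) R :=
  match n with
  | 0 => \d_([tuple] : 0.-tuple T)
  | n.+1 => distribution (product_probability P (power_probability n))
                         (@cons_pair n)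
  end.

Lemma power_probability_box n (A : 'I_n -> set T) :
  (forall i, measurable (A i)) ->
  (power_probability n [set t | forall i, A i (tnth t i)] =
   \prod_(i < n) P (A i))%E.
Proof.
elim: n A => [|n IHn] A mA.
  rewrite big_ord0 /= diracE mem_set//=; by case.
rewrite big_ord_recl -IHn//= -product_measure1E//.
  rewrite /distribution /pushforward/=; congr (_ _).
  apply/seteqP; split=> [[x t] /= Axt|[x t] /= [Ax At] i].
    split=> [|i]; first by have := Axt ord0; rewrite tnth0.
    by have := Axt (lift ord0 i); rewrite tnthS.
  case: (unliftP ord0 i) => [j|] ->; first by rewrite tnthS.
  by rewrite tnth0.
rewrite (_ : mkset _ = \bigcap_(i in [set: 'I_n])
    ((@tnth _ T ^~ i) @^-1` A (lift ord0 i))); last first.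
  by apply/seteqP; split=> [t /= At i _|t /= At i]; exact: At.
apply: fin_bigcap_measurable => // i _.
by rewrite -[X in measurable X]setTI; apply: measurable_tnth.
Qed.

End power_probability.

Section orthogonal_polynomial_ensemble.
Context (R : realType).
Variable mu : probability R R.

Definition measure_support : set R :=
  [set x | forall U : set R, open U -> U x -> (0 < mu U)%E].

Definition finite_moments : Prop :=
  forall k, mu.-integrable setT (fun x : R => (x ^+ k)%:E).

Definition orthonormal_polynomials (p : nat -> {poly R}) : Prop :=
  [/\ forall j, size (p j) = j.+1,
      forall j, 0 < lead_coef (p j) &
      forall i j,
        (\int[mu]_x ((p i).[x] * (p j).[x])%:E = ((i == j)%:R : R)%:E)%E].

Definition vandermonde_sq n (t : n.-tuple R) : R :=
  \prod_(i < n) \prod_(j < n | (j < i)%N)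
    (tnth t i - tnth t j) ^+ 2.

Definition ope_weight n (A : set (n.-tuple R)) : \bar R :=
  (\int[power_probability mu n]_(t in A) (vandermonde_sq t)%:E)%E.

Lemma vandermonde_sq_ge0 n (t : n.-tuple R) :
  0 <= vandermonde_sq t.
Proof. by do 2![apply: prodr_ge0 => ? _]; exact: sqr_ge0. Qed.

Lemma measurable_vandermonde_sq n : measurable_fun setT (@vandermonde_sq n).
Proof.
apply: measurable_prod => i _; under eq_fun do rewrite big_mkcond/=.
apply: measurable_prod => j _; case: (j < i)%N => //.
apply: measurable_funX.
by apply: measurable_funB; exact: measurable_tnth.
Qed.

Section ope_weight_measure.
Variable n : nat.

Let ope_weight0 : @ope_weight n set0 = 0%E.
Proof. by rewrite /ope_weight integral_set0. Qed.

Let ope_weight_ge0 A : (0 <= @ope_weight n A)%E.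
Proof. by apply: integral_ge0 => t _; rewrite lee_fin vandermonde_sq_ge0. Qed.

Let ope_weight_sigma_additive : semi_sigma_additive (@ope_weight n).
Proof.
move=> F mF tF mUF; rewrite /ope_weight ge0_integral_bigcup//.
- by apply: is_cvg_ereal_nneg_natsum_cond => k _ _; exact: ope_weight_ge0.
- apply/measurable_EFinP; apply: measurable_funS (@measurable_vandermonde_sq n).
  + exact: measurableT.
  + by [].
- by move=> t _; rewrite lee_fin vandermonde_sq_ge0.
Qed.

HB.instance Definition _ := isMeasure.Build _ _ _ (@ope_weight n)
  ope_weight0 ope_weight_ge0 ope_weight_sigma_additive.

End ope_weight_measure.

(* mnormalize divides by Z_n = ope_weight setT.  Its second argument is only a
   fallback for Z_n = 0 or Z_n = +oo, which do not occur when mu has finite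
   moments and infinite support. *)
Definition ope n : probability (n.-tuple R) R :=
  mnormalize (@ope_weight n) (power_probability mu n).

End orthogonal_polynomial_ensemble.

Definition linear_statistic (R : realType) (f : R -> R) n
    (t : n.-tuple R) : R :=
  \sum_(j < n) f (tnth t j).

Definition scaled_linear_statistic (R : realType) (f : R -> R)
    (alpha xstar : R) n (t : n.-tuple R) : R :=
  \sum_(j < n) f (n%:R `^ alpha * (tnth t j - xstar)).

(* Main.v *)
(* Write q_0, ..., q_(n-1) for the first n orthonormal polynomials and, for a
   Lipschitz function f, M_ij for the integral of f q_i q_j and N_ij for that of
   f^2 q_i q_j.  The density of the ensemble is det(q_j(l_i))^2 / n!, and
   expanding both determinants gives
     E (sum_i f(l_i))^2 = tr N + (tr M)^2 - tr M^2,
   hence, after centering f, Var (sum_i f(l_i)) <= tr N - tr M^2.  The right-hand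
   side, called dispersion below, equals
     1/2 int int (f(x) - f(y))^2 K(x,y)^2 dmu(x) dmu(y),  K(x,y) = sum_i q_i(x) q_i(y),
   so it is monotone in |f(x) - f(y)| and it suffices to compute it for f(x) = x.
   There the Christoffel-Darboux formula is not needed: x q_i has degree i + 1, so
   by Parseval tr N - tr M^2 only retains the coefficient of q_n in x q_(n-1),
   which is gamma_(n-1) / gamma_n.  This coefficient, the integral of
   x q_(n-1) q_n, is at most sup |x| over the support. *)

Require Import Defs.
From HB Require Import structures.
From mathcomp Require Import all_boot all_order all_algebra.
From mathcomp Require Import fingroup perm.
From mathcomp Require Import all_classical all_reals all_analysis.
From mathcomp Require Import measurable_realfun.
From mathcomp Require Import ring lra.

Set Implicit Arguments.
Unset Strict Implicit.
Unset Printing Implicit Defensive.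

Import Order.TTheory GRing.Theory Num.Theory.
Import numFieldNormedType.Exports.

Local Open Scope classical_set_scope.
Local Open Scope ring_scope.

(** * Integrals of products of one-variable functions over product measures *)

Section product_integral.
Context d (T : measurableType d) (R : realType).

(** Tonelli for the absolute values gives integrability, after which Fubini evaluates the
    integral. *)
Lemma integrable_Rintegral_prod d1 d2 (T1 : measurableType d1)
    (T2 : measurableType d2) (P1 : probability T1 R) (P2 : probability T2 R)
    (f : T1 -> R) (g : T2 -> R) :
  P1.-integrable setT (EFin \o f) -> P2.-integrable setT (EFin \o g) ->
  (P1 \x P2)%E.-integrable setT (fun z => (f z.1 * g z.2)%:E) /\
  (\int[(P1 \x P2)%E]_z (f z.1 * g z.2)%:E =
   (\int[P1]_x f x * \int[P2]_y g y)%:E)%E.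
Proof.
move=> intf intg.
have mf : measurable_fun setT f by apply/measurable_EFinP; case/integrableP: intf.
have mg : measurable_fun setT g by apply/measurable_EFinP; case/integrableP: intg.
have intfg : (P1 \x P2)%E.-integrable setT (fun z => (f z.1 * g z.2)%:E).
  apply/integrable12ltyP.
    apply/measurable_EFinP; apply: measurable_funM.
      exact: measurableT_comp.
    exact: measurableT_comp.
  rewrite (_ : integral _ _ _ =
      \int[P1]_x (`|(f x)%:E| * \int[P2]_y `|(g y)%:E|))%E; last first.
    apply: eq_integral => x _; rewrite -ge0_integralZl//; last first.
      by apply: measurableT_comp => //; exact/measurable_EFinP.
    by apply: eq_integral => y _; rewrite -abseM.
  rewrite ge0_integralZr//; last 2 first.
    by apply: measurableT_comp => //; exact/measurable_EFinP.
    exact: integral_ge0.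
  case/integrableP: intf => _ intf; case/integrableP: intg => _ intg.
  rewrite -ge0_fin_numE; last by apply: mule_ge0; exact: integral_ge0.
  by apply: fin_numM; rewrite ge0_fin_numE//; exact: integral_ge0.
split=> //.
have /= <- := integral12_prod_meas1 intfg; rewrite /fubini_F/=.
under eq_integral => x _.
  under eq_integral => y _ do rewrite EFinM.
  rewrite integralZl//.
  over.
have intgE : (\int[P2]_y (g y)%:E = (\int[P2]_y g y)%:E)%E.
  by rewrite /Rintegral fineK//; exact: integrable_fin_num.
rewrite /=; under eq_integral => x _ do rewrite intgE.
rewrite integralZr//.
by rewrite EFinM /Rintegral [in RHS]fineK//; exact: integrable_fin_num.
Qed.

Variable P : probability T R.

(** Induction along [cons_pair]: the power measure of order [n.+1] is the image of a product of [P]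
    with the power of order [n], over which the integrand splits. *)
Lemma integrable_power_prod n (f : 'I_n -> T -> R) :
  (forall i, P.-integrable setT (EFin \o f i)) ->
  (power_probability P n).-integrable setT
    (fun t => (\prod_(i < n) f i (tnth t i))%:E) /\
  (\int[power_probability P n]_t (\prod_(i < n) f i (tnth t i))%:E =
   (\prod_(i < n) \int[P]_x f i x)%:E)%E.
Proof.
elim: n f => [|n IHn] f intf.
  rewrite big_ord0; under eq_fun do rewrite big_ord0.
  split; first exact: finite_measure_integrable_cst.
  by rewrite integral_cst// -[RHS]mule1; congr (_ * _)%E; exact: probability_setT.
have [int_tl int_tlE] := IHn _ (fun i => intf (lift ord0 i)).
have [intp intpE] := integrable_Rintegral_prod (intf ord0) int_tl.
have mprod : measurable_fun setT
    (fun t : n.+1.-tuple T => (\prod_(i < n.+1) f i (tnth t i))%:E).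
  apply/measurable_EFinP; apply: measurable_prod => i _.
  have mfi : measurable_fun setT (f i).
    by apply/measurable_EFinP; case/integrableP: (intf i).
  by apply: measurableT_comp => //; exact: measurable_tnth.
have mcons : measurable_fun setT (@cons_pair _ T n) by exact: measurable_cons.
have compE : (fun t : n.+1.-tuple T => (\prod_(i < n.+1) f i (tnth t i))%:E)
    \o @cons_pair _ T n =
    (fun z => (f ord0 z.1 * \prod_(i < n) f (lift ord0 i) (tnth z.2 i))%:E).
  apply/funext => -[x t] /=; rewrite big_ord_recl tnth0; congr (_ * _)%:E.
  by apply: eq_bigr => i _; rewrite tnthS.
have intc : (product_probability P (power_probability P n)).-integrable setT
  ((fun t : n.+1.-tuple T => (\prod_(i < n.+1) f i (tnth t i))%:E)
    \o @cons_pair _ T n) by rewrite compE.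
split; first exact: (integrable_pushforward mcons mprod intc).
rewrite /= /distribution integral_pushforward//= preimage_setT.
transitivity (\int[product_probability P (power_probability P n)]_z
    (f ord0 z.1 * \prod_(i < n) f (lift ord0 i) (tnth z.2 i))%:E)%E.
  by apply: eq_integral => z _; exact: (congr1 (@^~ z) compE).
rewrite intpE big_ord_recl; congr (_ * _)%:E.
by rewrite /Rintegral int_tlE.
Qed.

End product_integral.

(** * Permutations with few moved points and determinants of matrices close to the identity *)

Section permutation_sums.
Local Open Scope group_scope.
Context (T : finType).

Lemma perm_fixing_others1 (a : T) (s : {perm T}) :
  (forall j, j != a -> s j = j) -> s = 1.
Proof.
move=> fixs; apply/permP => j; rewrite perm1.
have [->|/fixs//] := eqVneq j a.
apply/eqP/negPn/negP => /[dup] /fixs sa; rewrite -(inj_eq (@perm_inj _ s)) sa.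
by rewrite eqxx.
Qed.

(** If [a] is moved, it goes to [b], since any other image would be a fixed point and contradict
    injectivity. Composing with the transposition then leaves at most [b] to move. *)
Lemma perm_fixing_others2 (a b : T) (s : {perm T}) :
  (forall j, j != a -> j != b -> s j = j) -> s = 1 \/ s = tperm a b.
Proof.
move=> fixs; have [sa|sa] := eqVneq (s a) a.
  left; apply: (@perm_fixing_others1 b) => j jb.
  by have [->//|ja] := eqVneq j a; exact: fixs.
have sab : s a = b.
  apply/eqP/negPn/negP => /(fixs _ sa) /perm_inj /eqP.
  by rewrite (negPf sa).
right; rewrite -[s](mulgKV (tperm a b)) (_ : s * (tperm a b)^-1 = 1) ?mul1g//.
apply: (@perm_fixing_others1 b) => j jb; rewrite tpermV permM.
have [->|ja] := eqVneq j a; first by rewrite sab tpermR.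
by rewrite fixs// tpermD// eq_sym.
Qed.

End permutation_sums.

Section almost_identity_determinants.
Context (R : comPzRingType) (n : nat).
Implicit Types (B : 'M[R]_n) (a b : 'I_n).

(** In the Leibniz expansion, a permutation moving some [j != a] picks up an off-diagonal zero of
    row [j]; only the identity survives. *)
Lemma det_identity_but_one_row B a :
  (forall j k, j != a -> B j k = (j == k)%:R) -> \det B = B a a.
Proof.
move=> Bid; rewrite /determinant (bigD1 1%g)//= [X in _ + X]big1 ?addr0.
  rewrite odd_perm1 expr0 mul1r (bigD1 a)//= big1 ?mulr1 ?perm1//.
  by move=> j ja; rewrite perm1 Bid// eqxx.
move=> s s1; have [/existsP[j /andP[ja sj]]|] :=
    boolP [exists j, (j != a) && (s j != j)].
  by rewrite (bigD1 j)//= Bid// eq_sym (negPf sj) mul0r mulr0.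
rewrite negb_exists => /forallP fixs.
case/eqP: s1; apply: (@perm_fixing_others1 _ a) => j ja.
by have := fixs j; rewrite ja/= negbK => /eqP.
Qed.

(** Here the surviving permutations are the identity and [tperm a b], which together form a 2x2
    principal minor. *)
Lemma det_identity_but_two_rows B a b : a != b ->
  (forall j k, j != a -> j != b -> B j k = (j == k)%:R) ->
  \det B = B a a * B b b - B a b * B b a.
Proof.
move=> ab Bid; have ba : b != a by rewrite eq_sym.
have tab : tperm a b != 1%g :> 'S_n.
  by apply/eqP => /permP/(_ a); rewrite tpermL perm1; apply/eqP.
rewrite /determinant (bigD1 1%g)//= (bigD1 (tperm a b))//=.
rewrite [X in _ + (_ + X)]big1 ?addr0.
  rewrite odd_perm1 expr0 mul1r odd_tperm ab expr1 mulN1r; congr (_ - _).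
    rewrite (bigD1 a)//= (bigD1 b)//= big1 ?mulr1 ?perm1//.
    by move=> j /andP[ja jb]; rewrite perm1 Bid// eqxx.
  rewrite (bigD1 a)//= (bigD1 b)//= big1 ?mulr1 ?tpermL ?tpermR//.
  by move=> j /andP[ja jb]; rewrite tpermD 1?eq_sym// Bid// eqxx.
move=> s /andP[s1 st].
have [/existsP[j /and3P[ja jb sj]]|] :=
    boolP [exists j, [&& j != a, j != b & s j != j]].
  by rewrite (bigD1 j)//= Bid// eq_sym (negPf sj) mul0r mulr0.
rewrite negb_exists => /forallP fixs.
have /perm_fixing_others2[] : forall j, j != a -> j != b -> s j = j.
  by move=> j ja jb; have := fixs j; rewrite ja jb/= negbK => /eqP.
- by move/eqP: s1.
- by move/eqP: st.
Qed.

End almost_identity_determinants.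

(** * Integrals against a squared Slater determinant *)

Section slater_determinant.
Context d (T : measurableType d) (R : realType) (P : probability T R).

Lemma integrable_power_sum_prod n (I : finType) (c : I -> R)
    (f : I -> 'I_n -> T -> R) :
  (forall i j, P.-integrable setT (EFin \o f i j)) ->
  (power_probability P n).-integrable setT
    (fun t => (\sum_i c i * \prod_(j < n) f i j (tnth t j))%:E) /\
  (\int[power_probability P n]_t
      (\sum_i c i * \prod_(j < n) f i j (tnth t j))%:E =
   (\sum_i c i * \prod_(j < n) \int[P]_x f i j x)%:E)%E.
Proof.
move=> intf.
have int_i i : (power_probability P n).-integrable setT
    (fun t => (c i)%:E * (\prod_(j < n) f i j (tnth t j))%:E)%E.
  by apply: integrableZl => //; exact: (integrable_power_prod (intf i)).1.
have sumE : (fun t : n.-tuple T =>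
      (\sum_i c i * \prod_(j < n) f i j (tnth t j))%:E) =
    (fun t => \sum_i ((c i)%:E * (\prod_(j < n) f i j (tnth t j))%:E))%E.
  by apply/funext => t; rewrite -sumEFin; apply: eq_bigr => i _; rewrite EFinM.
rewrite sumE; split; first exact: integrable_sum.
rewrite integral_sum// -sumEFin; apply: eq_bigr => i _.
have [int_prod int_prodE] := integrable_power_prod (intf i).
by rewrite integralZl// int_prodE EFinM.
Qed.

Context (n : nat) (q : 'I_n -> T -> R) (f : T -> R).

(** Left unnormalized: for orthonormal [q] its square has integral n!. *)
Definition slater (t : n.-tuple T) : R :=
  \det (\matrix_(i < n, j < n) q j (tnth t i)).

(** For [e] equal to 0, 1, 2 these are the entries of the Gram matrix, of M and of N. *)
Definition moment (e : nat) (k l : 'I_n) : R :=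
  \int[P]_x (f x ^+ e * (q k x * q l x)).

Hypothesis integrable_moment : forall e k l, (e <= 2)%N ->
  P.-integrable setT (EFin \o (fun x => f x ^+ e * (q k x * q l x))).
Hypothesis orthonormal_q : forall k l, moment 0 k l = (k == l)%:R.

Lemma slater_sqr (t : n.-tuple T) : slater t ^+ 2 =
  \sum_(su : 'S_n * 'S_n) ((-1) ^+ su.1 * (-1) ^+ su.2) *
    \prod_(j < n) (q (su.1 j) (tnth t j) * q (su.2 j) (tnth t j)).
Proof.
rewrite expr2 /slater /determinant big_distrlr/= pair_big/=.
apply: eq_bigr => -[s u] _ /=; rewrite big_split/= mulrACA.
by congr (_ * (_ * _)); apply: eq_bigr => j _; rewrite mxE.
Qed.

(* Andreief's identity; for fixed s, the sum over the second permutation is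
   a determinant after the substitution u = v * s. *)
Lemma integral_slater_sqr (e : 'I_n -> nat) : (forall j, e j <= 2)%N ->
  (power_probability P n).-integrable setT
    (fun t => (\prod_(j < n) f (tnth t j) ^+ e j * slater t ^+ 2)%:E) /\
  (\int[power_probability P n]_t
      (\prod_(j < n) f (tnth t j) ^+ e j * slater t ^+ 2)%:E =
   (\sum_(s : 'S_n) \det (\matrix_(j < n, k < n) moment (e j) (s j) (s k)))%:E)%E.
Proof.
move=> e2.
have expand (t : n.-tuple T) : \prod_(j < n) f (tnth t j) ^+ e j * slater t ^+ 2 =
    \sum_(su : 'S_n * 'S_n) ((-1) ^+ su.1 * (-1) ^+ su.2) *
    \prod_(j < n) (f (tnth t j) ^+ e j *
                   (q (su.1 j) (tnth t j) * q (su.2 j) (tnth t j))).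
  rewrite slater_sqr mulr_sumr; apply: eq_bigr => su _.
  by rewrite [in RHS]big_split/= mulrCA.
under eq_fun do rewrite expand.
have [] := @integrable_power_sum_prod n _
  (fun su : 'S_n * 'S_n => (-1) ^+ su.1 * (-1) ^+ su.2)
  (fun su j x => f x ^+ e j * (q (su.1 j) x * q (su.2 j) x)).
  by move=> su j; exact: integrable_moment.
move=> int_sum ->; split=> //; congr EFin.
rewrite -(pair_bigA _ (fun s u : 'S_n => (-1) ^+ s * (-1) ^+ u *
  \prod_(j < n) moment (e j) (s j) (u j)))/=.
apply: eq_bigr => s _; rewrite (reindex_inj (@mulIg _ s))/= /determinant.
apply: eq_bigr => v _; rewrite odd_permM signr_addb mulrCA.
rewrite -signr_addb addbb mulr1; congr (_ * _).
by apply: eq_bigr => j _; rewrite mxE permM.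
Qed.

(** These exponents turn a product of two values into a product over all variables, the shape
    required by [integral_slater_sqr]; for [a = b] the exponent is 2. *)
Lemma prod_pred1_expr (a b : 'I_n) (g : 'I_n -> R) :
  \prod_(j < n) g j ^+ ((j == a) + (j == b)) = g a * g b.
Proof.
have prod1 c : \prod_(j < n) g j ^+ (j == c) = g c.
  rewrite (bigD1 c)//= eqxx expr1 big1 ?mulr1// => j /negPf ->.
  by rewrite expr0.
by under eq_bigr do rewrite exprD; rewrite big_split/= !prod1.
Qed.

(** With all exponents zero, each of the n! determinants in Andreief's identity is that of the
    identity matrix. *)
Lemma integral_slater_sqr1 :
  (\int[power_probability P n]_t (slater t ^+ 2)%:E = (n`!%:R : R)%:E)%E.
Proof.
have [//|_] := @integral_slater_sqr (fun=> 0%N).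
under eq_integral do rewrite big1 ?mul1r//.
move=> ->; congr EFin; transitivity (\sum_(s : 'S_n) (1 : R)); last first.
  by rewrite sumr_const card_Sn.
apply: eq_bigr => s _; rewrite -[RHS](det1 R n); congr (\det _).
by apply/matrixP => j k; rewrite !mxE orthonormal_q (inj_eq (@perm_inj _ s)).
Qed.

Lemma integral_sum_sqr_slater_sqr :
  (\int[power_probability P n]_t
     ((\sum_(j < n) f (tnth t j)) ^+ 2 * slater t ^+ 2)%:E =
   (n`!%:R * (\sum_i moment 2 i i + (\sum_i moment 1 i i) ^+ 2 -
      \sum_i \sum_j moment 1 i j * moment 1 j i))%:E)%E.
Proof.
pose e (ab : 'I_n * 'I_n) (j : 'I_n) := ((j == ab.1) + (j == ab.2))%N.
have e2 ab j : (e ab j <= 2)%N by rewrite /e; do 2 case: (_ == _).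
(* Orthonormality makes every row other than [a] and [b] a row of the identity, so the determinant
   is a diagonal entry of N when [a = b] and a 2x2 principal minor of M otherwise; [s] only relabels
   the indices. *)
pose F k l := if k == l then moment 2 k k
              else moment 1 k k * moment 1 l l - moment 1 k l * moment 1 l k.
have detE (s : 'S_n) ab :
    \det (\matrix_(j < n, k < n) moment (e ab j) (s j) (s k)) =
    F (s ab.1) (s ab.2).
  case: ab => a b; rewrite /F (inj_eq (@perm_inj _ s)) /e/=.
  have [<-|ab] := eqVneq a b.
    rewrite (@det_identity_but_one_row _ _ _ a) ?mxE ?eqxx// => j k /negPf ja.
    by rewrite mxE ja orthonormal_q (inj_eq (@perm_inj _ s)).
  have /negPf ba : b != a by rewrite eq_sym.
  rewrite (det_identity_but_two_rows ab) ?mxE ?eqxx ?(negPf ab) ?ba//.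
  move=> j k /negPf ja /negPf jb.
  by rewrite mxE ja jb orthonormal_q (inj_eq (@perm_inj _ s)).
have expand (t : n.-tuple T) : (\sum_(j < n) f (tnth t j)) ^+ 2 * slater t ^+ 2 =
    \sum_ab \prod_(j < n) f (tnth t j) ^+ e ab j * slater t ^+ 2.
  rewrite -mulr_suml; congr (_ * _).
  rewrite expr2 big_distrlr/= pair_big/=.
  by apply: eq_bigr => -[a b] _ /=; rewrite prod_pred1_expr.
under eq_integral do rewrite expand -sumEFin.
rewrite integral_sum//; last first.
  by move=> ab; exact: (integral_slater_sqr (e2 ab)).1.
under eq_bigr do rewrite (integral_slater_sqr (e2 _)).2.
rewrite sumEFin; congr EFin; rewrite exchange_big/=.
(* Summing over all pairs absorbs the relabelling, so each [s] contributes the same amount and n!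
   factors out. *)
have sumF (s : 'S_n) :
    \sum_ab \det (\matrix_(j < n, k < n) moment (e ab j) (s j) (s k)) =
    \sum_i \sum_j F i j.
  under eq_bigr do rewrite detE.
  rewrite -(pair_bigA _ (fun a b => F (s a) (s b)))/=.
  rewrite [RHS](reindex_inj (@perm_inj _ s))/=; apply: eq_bigr => a _.
  by rewrite [RHS](reindex_inj (@perm_inj _ s)).
under eq_bigr do rewrite sumF.
rewrite sumr_const card_Sn mulr_natl; congr (_ *+ _).
(* The diagonal terms of (tr M)^2 and tr M^2 cancel, which leaves room for exactly the diagonal of
   N. *)
rewrite -addrA expr2 big_distrlr/= -sumrB -big_split/=.
apply: eq_bigr => i _; rewrite -sumrB [in LHS](bigD1 i)//= [in RHS](bigD1 i)//=.
rewrite /F eqxx subrr add0r; congr (_ + _).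
by apply: eq_bigr => j /negPf ji; rewrite eq_sym ji.
Qed.

End slater_determinant.

(** * Integration against a measure given by a density *)

Section density.
Local Open Scope ereal_scope.
Context d (T : measurableType d) (R : realType).
Variables (nu m : {measure set T -> \bar R}) (w : T -> R).
Hypotheses (mw : measurable_fun setT w) (w0 : forall x, (0 <= w x)%R).
Hypothesis nuE : forall A, measurable A -> nu A = \int[m]_(x in A) (w x)%:E.

Import HBNNSimple.

(** The hypothesis [nuE] settles indicators, finite sums give simple functions, and monotone
    convergence on both sides passes to the limit. *)
Lemma ge0_integral_density (f : T -> \bar R) : measurable_fun setT f ->
  (forall x, 0 <= f x) ->
  \int[nu]_x f x = \int[m]_x (f x * (w x)%:E).
Proof.
move=> mf f0; pose h := nnsfun_approx measurableT mf.
have mwE : measurable_fun setT (EFin \o w) by exact/measurable_EFinP.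
have mh k : measurable_fun setT (EFin \o h k) by exact/measurable_EFinP.
transitivity (lim (\int[nu]_x (EFin \o h k) x @[k --> \oo])).
  rewrite -monotone_convergence//.
  - by apply: eq_integral => x _; apply/esym/cvg_lim => //;
      exact: cvg_nnsfun_approx.
  - by move=> k x _ /=; rewrite lee_fin.
  - by move=> x _ a b ab; rewrite lee_fin; exact/lefP/nd_nnsfun_approx.
transitivity (lim (\int[m]_x ((EFin \o h k) x * (w x)%:E) @[k --> \oo])); last first.
  rewrite -monotone_convergence//.
  - apply: eq_integral => x _; apply/cvg_lim => //; apply: cvgeZr => //.
    exact: cvg_nnsfun_approx.
  - by move=> k; exact: emeasurable_funM.
  - by move=> k x _ /=; rewrite mule_ge0// lee_fin.
  - move=> x _ a b ab /=; rewrite lee_wpmul2r ?lee_fin//.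
    exact/lefP/nd_nnsfun_approx.
congr (lim (_ @ \oo)); apply/funext => k.
have indic_ge0 r x : 0 <= (r * \1_(h k @^-1` [set r]) x)%:E.
  by rewrite EFinM; exact: nnfun_muleindic_ge0.
have mindic r : measurable_fun setT (fun x => (r * \1_(h k @^-1` [set r]) x)%:E).
  by apply/measurable_EFinP; exact: measurable_funM.
transitivity (\int[nu]_x
   (\sum_(r \in range (h k)) (r * \1_(h k @^-1` [set r]) x)%:E)).
  by apply: eq_integral => x _; rewrite /= fimfunE -fsumEFin.
rewrite ge0_integral_fsum//.
transitivity (\int[m]_x (\sum_(r \in range (h k))
    ((r * \1_(h k @^-1` [set r]) x)%:E * (w x)%:E))); last first.
  apply: eq_integral => x _; rewrite -ge0_mule_fsuml//.
  by rewrite fsumEFin// -(fimfunE _ x).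
rewrite ge0_integral_fsum//; last 2 first.
  - by move=> r; exact: emeasurable_funM.
  - by move=> r x _; rewrite mule_ge0// lee_fin.
apply: eq_fsbigr => r /[!inE] -[t _ rE].
have r0 : 0 <= r%:E by rewrite -rE lee_fin.
under eq_integral do rewrite EFinM.
rewrite integralZl_indic_nnsfun//.
under [RHS]eq_integral do rewrite EFinM -muleA.
rewrite [RHS]ge0_integralZl//; last 2 first.
  - apply: emeasurable_funM => //.
    by apply/measurable_EFinP.
  - by move=> x _; rewrite mule_ge0// lee_fin.
congr (_ * _); rewrite integral_indic// setIT nuE//.
rewrite integral_mkcond; apply: eq_integral => x _.
by rewrite epatch_indic muleC.
Qed.

End density.

(** A positive finite total mass excludes the fallback branch of [mnormalize]. *)
Lemma mnormalizeE d (T : measurableType d) (R : realType)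
    (m : {measure set T -> \bar R}) (P : probability T R) (z : R) (A : set T) :
  0 < z -> m setT = z%:E -> (mnormalize m P A = m A * z^-1%:E)%E.
Proof. by move=> z0 mz; rewrite /mnormalize mz eqe gt_eqF. Qed.

(** * The ensemble as a squared Slater determinant *)

Section ensemble_density.
Context (R : realType) (mu : probability R R).
Hypothesis mu_moments : finite_moments mu.
Variable p : nat -> {poly R}.
Hypothesis p_orthonormal : orthonormal_polynomials mu p.

Definition orthonormal_fun n (j : 'I_n) (x : R) : R := (p j).[x].

(** The matrix of values factors, up to transposition, into the coefficient matrix [C] and a
    Vandermonde matrix; [C] is triangular with the leading coefficients on its diagonal. *)
Lemma slater_vandermonde n (t : n.-tuple R) :
  slater (@orthonormal_fun n) t ^+ 2 =
  (\prod_(j < n) lead_coef (p j)) ^+ 2 * vandermonde_sq t.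
Proof.
have [size_p _ _] := p_orthonormal.
pose a : 'rV[R]_n := \row_j tnth t j.
pose C : 'M[R]_n := \matrix_(i, k) (p i)`_k.
have detC : \det C = \prod_(j < n) lead_coef (p j).
  rewrite det_trig; last first.
    apply/forallP => i; apply/forallP => j; apply/implyP => ij.
    by rewrite mxE nth_default// size_p.
  by apply: eq_bigr => i _; rewrite mxE lead_coefE size_p.
have -> : slater (@orthonormal_fun n) t = \det C * \det (Vandermonde n a).
  rewrite -det_mulmx -[RHS]det_tr; congr (\det _); apply/matrixP => i j.
  rewrite !mxE /orthonormal_fun (@horner_coef_wide _ n) ?size_p//.
  by apply: eq_bigr => k _; rewrite !mxE.
rewrite detC exprMn det_Vandermonde; congr (_ * _).
rewrite /vandermonde_sq (exchange_big_dep xpredT)//= -prodrXl.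
apply: eq_bigr => i _; rewrite -prodrXl; apply: eq_bigr => j _.
by rewrite !mxE.
Qed.

(** A class containing polynomials and Lipschitz functions, closed under products and powers, and
    integrable because [mu] has finite moments. It settles all integrability questions about one
    variable below. *)
Definition poly_dominated (f : R -> R) :=
  measurable_fun setT f /\ exists q : {poly R}, forall x, `|f x| <= q.[x].

Lemma poly_dominatedM f g : poly_dominated f -> poly_dominated g ->
  poly_dominated (fun x => f x * g x).
Proof.
move=> [mf [q fq]] [mg [r gr]]; split; first exact: measurable_funM.
by exists (q * r) => x; rewrite normrM hornerM ler_pM.
Qed.

Lemma poly_dominated_horner (q : {poly R}) : poly_dominated (horner q).
Proof.
split; first by apply: continuous_measurable_fun; exact: continuous_horner.
(* The absolute value of [q] need not be a polynomial; |a| <= 1 + a^2 replaces it by one. *)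
exists (1 + q ^+ 2) => x; rewrite hornerD horner_exp hornerE -real_normK ?num_real//.
by have := sqr_ge0 (`|q.[x]| - 1); have := normr_ge0 q.[x]; nra.
Qed.

Lemma poly_dominatedX f e : poly_dominated f ->
  poly_dominated (fun x => f x ^+ e).
Proof.
move=> [mf [q fq]]; split; first exact: measurable_funX.
exists (q ^+ e) => x; rewrite normrX horner_exp.
by apply: lerXn2r => //; rewrite nnegrE ?(le_trans _ (fq x)).
Qed.

Lemma lipschitz_measurable (L : R) (f : R -> R) :
  (forall x y, `|f x - f y| <= L * `|x - y|) -> measurable_fun setT f.
Proof.
move=> lipf; apply: continuous_measurable_fun => x.
have L0 : 0 <= L.
  by have := lipf 1 0; rewrite subr0 normr1 mulr1; exact: le_trans.
(* [L] may vanish, so [L + 1] serves as the constant to divide by. *)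
have L1 : 0 < L + 1 by rewrite ltr_wpDl.
apply/cvgrPdist_le => e e0; near=> y; apply: (le_trans (lipf x y)).
apply: (@le_trans _ _ ((L + 1) * `|x - y|)).
  by rewrite ler_wpM2r// lerDl.
rewrite mulrC -ler_pdivlMr//; near: y.
by apply: (@cvgr_dist_le _ _ _ _ _ id _ cvg_id); exact: divr_gt0.
Unshelve. all: by end_near. Qed.

Lemma poly_dominated_lipschitz (L : R) (f : R -> R) :
  (forall x y, `|f x - f y| <= L * `|x - y|) -> poly_dominated f.
Proof.
move=> lipf; split; first exact: lipschitz_measurable lipf.
exists (`|f 0|%:P + L%:P * (1 + 'X^2)) => x; rewrite !hornerE/=.
have L0 : 0 <= L.
  by have := lipf 1 0; rewrite subr0 normr1 mulr1; exact: le_trans.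
have := lipf x 0; rewrite subr0 => lipx0.
have := ler_normD (f x - f 0) (f 0); rewrite subrK => /le_trans; apply.
rewrite addrC lerD2l; apply: (le_trans lipx0); apply: ler_wpM2l => //.
rewrite -[x ^+ 2]real_normK ?num_real//.
by have := sqr_ge0 (`|x| - 1); have := normr_ge0 x; nra.
Qed.

Lemma integrable_poly (q : {poly R}) : mu.-integrable setT (EFin \o horner q).
Proof.
rewrite (_ : EFin \o _ = fun x => \sum_(i < size q) (q`_i)%:E * (x ^+ i)%:E)%E.
  apply: integrable_sum => // i _; exact: integrableZl.
apply/funext => x /=; rewrite horner_coef -sumEFin.
by apply: eq_bigr => i _; rewrite EFinM.
Qed.

Lemma integrable_poly_dominated f : poly_dominated f ->
  mu.-integrable setT (EFin \o f).
Proof.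
move=> [mf [q fq]]; apply: le_integrable (integrable_poly q) => //.
  exact/measurable_EFinP.
by move=> x _ /=; rewrite lee_fin (le_trans (fq x))// ler_norm.
Qed.

Lemma integrable_orthonormal_moment n f e (k l : 'I_n) : poly_dominated f ->
  mu.-integrable setT
    (EFin \o (fun x => f x ^+ e * (orthonormal_fun k x * orthonormal_fun l x))).
Proof.
move=> domf; apply: integrable_poly_dominated; apply: poly_dominatedM.
  exact: poly_dominatedX.
by apply: poly_dominatedM; exact: poly_dominated_horner.
Qed.

Lemma Rintegral_orthonormal i j : \int[mu]_x ((p i).[x] * (p j).[x]) = (i == j)%:R.
Proof. by have [_ _ orth] := p_orthonormal; rewrite /Rintegral orth. Qed.

Lemma moment0_orthonormal n f (k l : 'I_n) :
  moment mu (@orthonormal_fun n) f 0 k l = (k == l)%:R.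
Proof.
rewrite /moment; under eq_Rintegral do rewrite expr0 mul1r.
exact: Rintegral_orthonormal.
Qed.

Lemma measurable_slater n : measurable_fun setT (slater (@orthonormal_fun n)).
Proof.
apply: measurable_sum => s; apply: measurable_funM => //.
apply: measurable_prod => i _; under eq_fun do rewrite mxE.
apply: (measurableT_comp (f := @orthonormal_fun n (s i))).
  exact: (poly_dominated_horner _).1.
exact: measurable_tnth.
Qed.

(** The squared leading coefficients from [slater_vandermonde] occur in the weight and in Z_n alike
    and cancel, which leaves n! as the normalization. *)
Lemma ope_slater n (A : set (n.-tuple R)) : measurable A ->
  (ope mu n A = \int[power_probability mu n]_(t in A)
                  (slater (@orthonormal_fun n) t ^+ 2 / n`!%:R)%:E)%E.
Proof.
move=> mA; have [_ lead_gt0 _] := p_orthonormal.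
pose G := (\prod_(j < n) lead_coef (p j)) ^+ 2.
have G0 : 0 < G by rewrite exprn_gt0// prodr_gt0.
have n0 : 0 < (n`!%:R : R) by rewrite ltr0n fact_gt0.
have vdmE B : measurable B -> (ope_weight mu B =
    G^-1%:E * \int[power_probability mu n]_(t in B)
                (slater (@orthonormal_fun n) t ^+ 2)%:E)%E.
  move=> mB; rewrite -ge0_integralZl//; last 3 first.
  - by apply/measurable_EFinP; apply: measurable_funTS;
      apply: measurable_funX; exact: measurable_slater.
  - by move=> t _; rewrite lee_fin sqr_ge0.
  - by rewrite lee_fin invr_ge0 ltW.
  apply: eq_integral => t _; rewrite -EFinM slater_vandermonde mulKf//.
  by rewrite gt_eqF.
(* The constant 1 instantiates the function [f] of [integral_slater_sqr1]. *)
have dom1 : poly_dominated (fun=> 1).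
  have -> : (fun=> 1) = horner (1 : {poly R}) by apply/funext => x; rewrite hornerE.
  exact: poly_dominated_horner.
have ZE : (ope_weight mu [set: n.-tuple R] = (n`!%:R / G)%:E)%E.
  rewrite vdmE// (@integral_slater_sqr1 _ _ _ _ _ _ (fun=> 1)) -?EFinM 1?mulrC//.
    by move=> e k l _; exact: integrable_orthonormal_moment.
  by move=> k l; exact: moment0_orthonormal.
have nG : 0 < n`!%:R / G by exact: divr_gt0.
have -> : ope mu n A = (ope_weight mu A * (n`!%:R / G)^-1%:E)%E.
  exact: mnormalizeE.
rewrite vdmE//.
rewrite muleC muleA -EFinM invf_div mulrAC divff ?mul1r ?gt_eqF//.
rewrite -ge0_integralZl//.
- by apply: eq_integral => t _; rewrite -EFinM mulrC.
- by apply/measurable_EFinP; apply: measurable_funTS;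
    apply: measurable_funX; exact: measurable_slater.
- by move=> t _; rewrite lee_fin sqr_ge0.
Qed.

Lemma ope_second_moment n f : poly_dominated f ->
  (\int[ope mu n]_t (linear_statistic f t ^+ 2)%:E =
   (\sum_i moment mu (@orthonormal_fun n) f 2 i i +
    (\sum_i moment mu (@orthonormal_fun n) f 1 i i) ^+ 2 -
    \sum_i \sum_j moment mu (@orthonormal_fun n) f 1 i j *
                  moment mu (@orthonormal_fun n) f 1 j i)%:E)%E.
Proof.
move=> domf; have n0 : 0 < (n`!%:R : R) by rewrite ltr0n fact_gt0.
have mls : measurable_fun setT (fun t : n.-tuple R => linear_statistic f t ^+ 2).
  apply: measurable_funX; apply: measurable_sum => i.
  by apply: (measurableT_comp domf.1); exact: measurable_tnth.
have msl : measurable_fun setT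
    (fun t : n.-tuple R => slater (@orthonormal_fun n) t ^+ 2).
  by apply: measurable_funX; exact: measurable_slater.
rewrite (ge0_integral_density _ _ (@ope_slater n))//; last 4 first.
- by apply: measurable_funM.
- by move=> t; rewrite mulr_ge0 ?sqr_ge0// invr_ge0 ltW.
- exact/measurable_EFinP.
- by move=> t; rewrite lee_fin sqr_ge0.
under eq_integral do rewrite -EFinM mulrA mulrC EFinM.
rewrite ge0_integralZl//; last 2 first.
- by apply/measurable_EFinP; exact: measurable_funM.
- by move=> t _; rewrite lee_fin mulr_ge0// sqr_ge0.
rewrite integral_sum_sqr_slater_sqr.
- by rewrite -EFinM mulKf// gt_eqF.
- by move=> e k l _; exact: integrable_orthonormal_moment.
- by move=> k l; exact: moment0_orthonormal.
Qed.

End ensemble_density.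

(** Variance is unchanged by the shift [c] and is at most the second moment. Square integrability of
    [X], needed for both, comes from the finite value [v]. *)
Lemma variance_le_second_moment d (T : measurableType d) (R : realType)
    (P : probability T R) (X : T -> R) (c v : R) : measurable_fun setT X ->
  (\int[P]_t ((X t - c) ^+ 2)%:E = v%:E)%E -> (variance P X <= v%:E)%E.
Proof.
move=> mX intX.
have mXc : measurable_fun setT (fun t => X t - c) by exact: measurable_funB.
have Xc2 : (X \- cst c)%R \in Lfun P 2%:E.
  rewrite inE; apply/andP; split; rewrite inE//=.
  rewrite /finite_norm unlock /Lnorm; apply: poweR_lty.
  rewrite (eq_integral (fun t => ((X t - c) ^+ 2)%:E)) ?intX ?ltry// => t _.
  by rewrite /= powR_mulrn// real_normK ?num_real.
have X2 : X \in Lfun P 2%:E.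
  have -> : X = ((X \- cst c) + cst c)%R.
    by apply/funext => t; rewrite fctE/= subrK.
  by rewrite rpredD ?lee1n//= => _; exact: Lfun_cst.
rewrite -(varianceB_cst_r c X2) varianceE//.
have -> : ('E_P[((X \- cst c) ^+ 2)%R] = v%:E)%E.
  by rewrite unlock -intX; apply: eq_integral => t _; rewrite fctE.
rewrite -[leRHS]adde0 leeD2l// leeNl oppe0.
(* The subtracted square is nonnegative for every extended real value of the expectation. *)
by rewrite expe2; case: ('E_P[_])%E => // r; rewrite -EFinM lee_fin -expr2 sqr_ge0.
Qed.

(** * The dispersion and its monotonicity *)

Section orthonormal_moments.
Context (R : realType) (mu : probability R R).
Hypothesis mu_moments : finite_moments mu.
Variable p : nat -> {poly R}.
Hypothesis p_orthonormal : orthonormal_polynomials mu p.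

Lemma integrable_scale (c : R) (f : R -> R) :
  mu.-integrable setT (EFin \o f) ->
  mu.-integrable setT (EFin \o (fun x => c * f x)).
Proof. by move=> intf; exact: (integrableZl _ c intf). Qed.

Lemma integrable_lincomb (I : finType) (c : I -> R) (g : I -> R -> R) :
  (forall i, mu.-integrable setT (EFin \o g i)) ->
  mu.-integrable setT (EFin \o (fun x => \sum_i c i * g i x)) /\
  \int[mu]_x (\sum_i c i * g i x) = \sum_i c i * \int[mu]_x g i x.
Proof.
move=> intg.
have intcg i : mu.-integrable setT (fun x => ((c i)%:E * (g i x)%:E)%E).
  by apply: integrableZl => //; exact: intg.
have sumE : EFin \o (fun x => \sum_i c i * g i x) =
    (fun x => \sum_i ((c i)%:E * (g i x)%:E))%E.
  by apply/funext => x /=; rewrite -sumEFin; apply: eq_bigr => i _; rewrite EFinM.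
rewrite sumE; split; first exact: integrable_sum.
rewrite /Rintegral; have /= -> := congr1 (integral mu setT) sumE.
rewrite integral_sum// (eq_bigr (fun i => (c i * \int[mu]_x g i x)%:E)) ?sumEFin//.
move=> i _; rewrite integralZl//; last exact: intg.
rewrite EFinM /Rintegral fineK//.
exact: (integrable_fin_num _ (intg i)).
Qed.

Section dispersion.
Variable n : nat.
Implicit Types (f g : R -> R) (i j : 'I_n).

Let q := @orthonormal_fun R p n.

Definition cd_kernel (x y : R) : R := \sum_i q i x * q i y.

Definition dispersion f : R :=
  \sum_i moment mu q f 2 i i -
  \sum_i \sum_j moment mu q f 1 i j * moment mu q f 1 j i.

(** Separation of variables: [k.1] selects a term of the squared kernel and [k.2] a term of the
    binomial expansion, so integrating in [y] and then in [x] only produces moments. *)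
Lemma cd_kernel_sqr f x y : (f x - f y) ^+ 2 * cd_kernel x y ^+ 2 =
  \sum_(k : 'I_n * 'I_n * 'I_3)
    (-1) ^+ k.2 * 'C(2, k.2)%:R * (f x ^+ (2 - k.2) * (q k.1.1 x * q k.1.2 x)) *
    (f y ^+ k.2 * (q k.1.1 y * q k.1.2 y)).
Proof.
rewrite [cd_kernel x y ^+ 2]expr2 /cd_kernel big_distrlr/= pair_big mulr_sumr.
rewrite -(pair_bigA _ (fun (ij : 'I_n * 'I_n) (e : 'I_3) =>
    (-1) ^+ e * 'C(2, e)%:R * (f x ^+ (2 - e) * (q ij.1 x * q ij.2 x)) *
    (f y ^+ e * (q ij.1 y * q ij.2 y))))/=.
apply: eq_bigr => -[i j] _; rewrite !big_ord_recl big_ord0/= /bump/= .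
by rewrite !addn0 addn1 bin0 bin1 binn subn0 subnn subSS subn0; ring.
Qed.

Let integrable_moment f e i j : poly_dominated f ->
  mu.-integrable setT (EFin \o (fun x => f x ^+ e * (q i x * q j x))).
Proof. exact: integrable_orthonormal_moment. Qed.

Lemma integrable_cd_kernel f x : poly_dominated f ->
  mu.-integrable setT (EFin \o (fun y => (f x - f y) ^+ 2 * cd_kernel x y ^+ 2)).
Proof.
move=> domf; under eq_fun do rewrite cd_kernel_sqr.
by apply: (integrable_lincomb _ _).1 => k; exact: integrable_moment.
Qed.

(** Of the binomial terms, exponents 0 and 2 each collapse to tr N by orthonormality, and exponent 1
    gives -2 tr M^2 because M is symmetric. *)
Lemma dispersionE f : poly_dominated f ->
  mu.-integrable setT (EFin \o
    (fun x => \int[mu]_y ((f x - f y) ^+ 2 * cd_kernel x y ^+ 2))) /\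
  \int[mu]_x (\int[mu]_y ((f x - f y) ^+ 2 * cd_kernel x y ^+ 2)) =
  2 * dispersion f.
Proof.
move=> domf.
have innerE x : \int[mu]_y ((f x - f y) ^+ 2 * cd_kernel x y ^+ 2) =
    \sum_(k : 'I_n * 'I_n * 'I_3)
    (-1) ^+ k.2 * 'C(2, k.2)%:R * moment mu q f k.2 k.1.1 k.1.2 *
    (f x ^+ (2 - k.2) * (q k.1.1 x * q k.1.2 x)).
  under eq_Rintegral do rewrite cd_kernel_sqr.
  rewrite (integrable_lincomb _ _).2; last first.
    by move=> k; exact: integrable_moment.
  by apply: eq_bigr => k _; rewrite -/(moment mu q f _ _ _) mulrAC.
have -> : (fun x => \int[mu]_y ((f x - f y) ^+ 2 * cd_kernel x y ^+ 2)) =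
  (fun x => \sum_(k : 'I_n * 'I_n * 'I_3)
    (-1) ^+ k.2 * 'C(2, k.2)%:R * moment mu q f k.2 k.1.1 k.1.2 *
    (f x ^+ (2 - k.2) * (q k.1.1 x * q k.1.2 x))) by exact/funext.
have [] := @integrable_lincomb _ (fun k : 'I_n * 'I_n * 'I_3 =>
    (-1) ^+ k.2 * 'C(2, k.2)%:R * moment mu q f k.2 k.1.1 k.1.2)
  (fun k x => f x ^+ (2 - k.2) * (q k.1.1 x * q k.1.2 x)).
  by move=> k; exact: integrable_moment.
move=> int_k ->; split=> //.
rewrite -(pair_bigA _ (fun (ij : 'I_n * 'I_n) (e : 'I_3) =>
    (-1) ^+ e * 'C(2, e)%:R * moment mu q f e ij.1 ij.2 *
    moment mu q f (2 - e) ij.1 ij.2))/=.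
rewrite -(pair_bigA _ (fun i j => \sum_(e : 'I_3)
    (-1) ^+ e * 'C(2, e)%:R * moment mu q f e i j * moment mu q f (2 - e) i j))/=.
rewrite /dispersion -sumrB mulr_sumr; apply: eq_bigr => i _.
rewrite (eq_bigr (fun j => 2 * (i == j)%:R * moment mu q f 2 i j -
   2 * (moment mu q f 1 i j * moment mu q f 1 j i))).
  rewrite sumrB -mulr_sumr mulrBr; congr (_ - _).
  rewrite (bigD1 i)//= eqxx big1 ?addr0 ?mulr1// => j /negPf.
  by rewrite eq_sym => ->; rewrite mulr0 mul0r.
move=> j _; have -> : moment mu q f 1 j i = moment mu q f 1 i j.
  by apply: eq_Rintegral => x _; rewrite [q j x * _]mulrC.
rewrite !big_ord_recl big_ord0/= /bump/= !addn0 addn1.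
rewrite bin0 bin1 binn subn0 subnn subSS subn0.
by rewrite /q (moment0_orthonormal p_orthonormal); ring.
Qed.

(** In the double integral of [dispersionE] the weight is a square, so the integrands can be
    compared pointwise. *)
Lemma le_dispersion f g (c : R) : poly_dominated f -> poly_dominated g ->
  (forall x y, `|g x - g y| <= c * `|f x - f y|) ->
  dispersion g <= c ^+ 2 * dispersion f.
Proof.
move=> domf domg gf.
have [intg gE] := dispersionE domg; have [intf fE] := dispersionE domf.
suff : 2 * dispersion g <= c ^+ 2 * (2 * dispersion f) by lra.
rewrite -gE -fE -RintegralZl//; apply: le_Rintegral => //.
  exact: integrable_scale.
move=> x _; rewrite -RintegralZl//; last exact: integrable_cd_kernel.
apply: le_Rintegral => //.
- exact: integrable_cd_kernel.
- by apply: integrable_scale; exact: integrable_cd_kernel.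
- move=> y _; rewrite mulrA ler_wpM2r ?sqr_ge0//.
  (* The sign of [c] is not prescribed, so the comparison goes through its absolute value before
     squaring. *)
  rewrite -[leLHS]real_normK ?num_real// -exprMn -[leRHS]real_normK ?num_real//.
  apply: lerXn2r; rewrite ?nnegrE// normrM; apply: (le_trans (gf x y)).
  by rewrite ler_wpM2r// ler_norm.
Qed.

End dispersion.

End orthonormal_moments.

(** * Orthogonal expansion of polynomials and the dispersion of the identity function *)

Section jacobi_coefficient.
Context (R : realType) (mu : probability R R).
Hypothesis mu_moments : finite_moments mu.
Variable p : nat -> {poly R}.
Hypothesis p_orthonormal : orthonormal_polynomials mu p.
Implicit Types (q r : {poly R}).

(** Integration viewed as a linear functional on [{poly R}], which makes the orthogonality arguments
    algebraic. *)
Definition poly_mean q : R := \int[mu]_x q.[x].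

Lemma poly_meanD q r : poly_mean (q + r) = poly_mean q + poly_mean r.
Proof.
rewrite /poly_mean; under eq_Rintegral do rewrite hornerD.
by rewrite RintegralD//; exact: (integrable_poly mu_moments).
Qed.

Lemma poly_meanZ c q : poly_mean (c *: q) = c * poly_mean q.
Proof.
rewrite /poly_mean; under eq_Rintegral do rewrite hornerZ.
by rewrite RintegralZl//; exact: (integrable_poly mu_moments).
Qed.

Lemma poly_mean_sum n (F : 'I_n -> {poly R}) :
  poly_mean (\sum_i F i) = \sum_i poly_mean (F i).
Proof.
apply: (big_morph _ poly_meanD); rewrite -[X in poly_mean X](scale0r 0).
by rewrite poly_meanZ mul0r.
Qed.

Lemma poly_mean_orthonormal i j : poly_mean (p i * p j) = (i == j)%:R.
Proof.
rewrite -(Rintegral_orthonormal p_orthonormal).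
by apply: eq_Rintegral => x _; rewrite hornerM.
Qed.

Lemma lead_coef_orthonormal_gt0 n : 0 < lead_coef (p n).
Proof. by have [] := p_orthonormal. Qed.

(** The multiple of [p n] is chosen to cancel the coefficient of degree [n]; this is the induction
    step for expanding in the [p j]. *)
Lemma size_sub_lead n q : (size q <= n.+1)%N ->
  (size (q - (q`_n / lead_coef (p n)) *: p n)%R <= n)%N.
Proof.
have [size_p _ _] := p_orthonormal => sq; apply/leq_sizeP => j.
rewrite leq_eqVlt => /predU1P[<-|nj]; rewrite coefB coefZ.
  rewrite [lead_coef _]lead_coefE size_p/= divfK ?subrr//.
  have := lead_coef_orthonormal_gt0 n; rewrite lead_coefE size_p/=.
  by move/lt0r_neq0.
rewrite (@nth_default _ _ q) ?(leq_trans sq)//.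
by rewrite (@nth_default _ _ (p n)) ?size_p// mulr0 subrr.
Qed.

Lemma orthonormal_span n q : (size q <= n)%N ->
  exists c : 'I_n -> R, q = \sum_(j < n) c j *: p j.
Proof.
elim: n q => [|n IHn] q sq.
  exists (fun=> 0); rewrite big_ord0; apply/eqP.
  by rewrite -size_poly_eq0 -leqn0.
have [c qE] := IHn _ (size_sub_lead sq).
(* Indices below [n] keep their coefficient from [c]; the last index falls outside ['I_n] and
   receives the default, the quotient just split off. *)
exists (fun j => oapp c (q`_n / lead_coef (p n)) (insub (val j))).
rewrite big_ord_recr/= insubF ?ltnn//=.
rewrite -[LHS](subrK ((q`_n / lead_coef (p n)) *: p n)) {1}qE; congr (_ + _).
by apply: eq_bigr => j _; rewrite valK.
Qed.

Lemma poly_mean_orthogonal n q : (size q <= n)%N -> poly_mean (q * p n) = 0.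
Proof.
move=> /orthonormal_span[c ->]; rewrite mulr_suml poly_mean_sum big1// => j _.
by rewrite -scalerAl poly_meanZ poly_mean_orthonormal ltn_eqF ?mulr0.
Qed.

(** After the top term is split off, the remainder has degree below [n] and is orthogonal to
    [p n]. *)
Lemma poly_mean_lead n q : (size q <= n.+1)%N ->
  poly_mean (q * p n) = q`_n / lead_coef (p n).
Proof.
move=> sq; have := poly_mean_orthogonal (size_sub_lead sq).
rewrite mulrBl -scaleN1r poly_meanD poly_meanZ -scalerAl poly_meanZ.
by rewrite poly_mean_orthonormal eqxx mulr1 mulN1r => /eqP; rewrite subr_eq0 => /eqP.
Qed.

Lemma poly_mean_parseval n q : (size q <= n)%N ->
  poly_mean (q * q) = \sum_(j < n) poly_mean (q * p j) ^+ 2.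
Proof.
move=> /orthonormal_span[c qE].
have coefE (j : 'I_n) : poly_mean (q * p j) = c j.
  rewrite qE mulr_suml poly_mean_sum (bigD1 j)//= big1 ?addr0.
    by rewrite -scalerAl poly_meanZ poly_mean_orthonormal eqxx mulr1.
  move=> i ij; rewrite -scalerAl poly_meanZ poly_mean_orthonormal.
  by rewrite (inj_eq val_inj) (negPf ij) mulr0.
rewrite {2}qE mulr_sumr poly_mean_sum; apply: eq_bigr => j _.
by rewrite -scalerAr poly_meanZ coefE expr2.
Qed.

Lemma size_mulX_orthonormal n : size ('X * p n) = n.+2.
Proof.
have [size_p _ _] := p_orthonormal.
by rewrite -commr_polyX size_mulX ?size_p// -size_poly_eq0 size_p.
Qed.

Lemma poly_mean_mulX_lead n :
  poly_mean ('X * p n * p n.+1) = lead_coef (p n) / lead_coef (p n.+1).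
Proof.
rewrite poly_mean_lead ?size_mulX_orthonormal// -commr_polyX coefMX/=.
by have [size_p _ _] := p_orthonormal; rewrite [lead_coef (p n)]lead_coefE size_p.
Qed.

Lemma dispersion_id n :
  dispersion mu p n.+1 id = (lead_coef (p n) / lead_coef (p n.+1)) ^+ 2.
Proof.
(* Parseval for X p_k, of degree at most n + 1: the sum has one more index than the matrix M. *)
have m2E (k : 'I_n.+1) : moment mu (@orthonormal_fun R p n.+1) id 2 k k =
    \sum_(l < n.+2) poly_mean ('X * p k * p l) ^+ 2.
  rewrite -poly_mean_parseval; last by rewrite size_mulX_orthonormal ltnS ltn_ord.
  by apply: eq_Rintegral => x _; rewrite !hornerE /orthonormal_fun/=; ring.
have m1E : forall k l, moment mu (@orthonormal_fun R p n.+1) id 1 k l =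
    poly_mean ('X * p k * p l).
  by move=> k l; apply: eq_Rintegral => x _; rewrite !hornerE /orthonormal_fun/=; ring.
have m1C k l : poly_mean ('X * p k * p l) = poly_mean ('X * p l * p k).
  by rewrite mulrAC.
rewrite /dispersion -sumrB big_ord_recr/= big1 ?add0r => [|i _].
  (* In the last row the extra Parseval term, with index [n.+1], is the one that remains. *)
  rewrite m2E big_ord_recr/= -poly_mean_mulX_lead [X in X - _]addrC -addrA.
  rewrite -[RHS]addr0; congr (_ + _); apply/eqP; rewrite subr_eq0; apply/eqP.
  by apply: eq_bigr => j _; rewrite !m1E (m1C j n) expr2.
(* In the other rows X p_i has degree at most n, so the extra term vanishes and the row cancels
   completely. *)
rewrite m2E big_ord_recr/= poly_mean_orthogonal ?expr0n ?addr0; last first.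
  by rewrite size_mulX_orthonormal ltnS ltn_ord.
apply/eqP; rewrite subr_eq0; apply/eqP.
by apply: eq_bigr => j _; rewrite !m1E (m1C j i) expr2.
Qed.

End jacobi_coefficient.

(** * Compact support confines the measure to a bounded interval *)

Section compact_support.
Context (R : realType) (mu : probability R R).

(* The complement of the support is covered by the countably many null
   intervals with rational endpoints. *)
Lemma measure_support_negligible : mu.-negligible (~` measure_support mu).
Proof.
pose J (ab : rat * rat) : set R := `]ratr ab.1, ratr ab.2[%classic.
(* Intervals of positive mass are replaced by the empty set, as are the natural numbers that code no
   pair of rationals in [F]. *)
pose N ab := if mu (J ab) == 0%E then J ab else set0.
pose F k := oapp N set0 (unpickle k).
have N0 ab : mu.-negligible (N ab).
  rewrite /N; case: eqP => [J0|_]; last exact: negligible_set0.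
  by exists (J ab); split => //; exact: measurable_itv.
have FN ab : F (pickle ab) = N ab by rewrite /F pickleK.
apply: (@negligibleS _ _ _ _ (\bigcup_k F k)).
  move=> x /= /existsNP[U] /not_implyP[oU] /not_implyP[Ux] /negP.
  rewrite -leNgt measure_le0 => /eqP U0.
  have /nbhs_ballP[e /= e0 xeU] : nbhs x U by exact: open_nbhs_nbhs.
  have [a] := @rat_in_itvoo R (x - e) x ltac:(by rewrite ltrBlDr ltrDl).
  rewrite in_itv/= => /andP[xea ax].
  have [b] := @rat_in_itvoo R x (x + e) ltac:(by rewrite ltrDl).
  rewrite in_itv/= => /andP[xb bxe].
  exists (pickle (a, b)); first exact: I.
  rewrite FN /N ifT; first by rewrite /J/= in_itv/= ax xb.
  rewrite -measure_le0 -U0; apply: le_measure; rewrite ?inE.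
  - exact: measurable_itv.
  - exact: open_measurable.
  move=> y; rewrite /J/= in_itv/= => /andP[ay yb]; apply: xeU.
  rewrite -ball_normE/= ltr_norml; apply/andP; split; lra.
apply: negligible_bigcup => k; rewrite /F; case: unpickle => [ab|]; first exact: N0.
exact: negligible_set0.
Qed.

Lemma measurable_norm_gt (B : R) : measurable [set x : R | B < `|x|].
Proof.
rewrite (_ : [set x | _] = Num.norm @^-1` `]B, +oo[%classic); last first.
  by apply/seteqP; split => x /=; rewrite in_itv/= andbT.
rewrite -[X in measurable X]setTI.
by apply: normr_measurable => //; exact: measurable_itv.
Qed.

Lemma compact_support_bounded : compact (measure_support mu) ->
  exists B, 0 <= B /\ mu [set x | B < `|x|] = 0%E.
Proof.
(* Boundedness provides every number strictly above [B0] as a bound, hence [B0 + 1]; the maximum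
   makes it nonnegative. *)
move=> /compact_bounded[B0 [_ B0P]]; pose B := Num.max 0 (B0 + 1).
have BP : forall x, measure_support mu x -> `|x| <= B.
  by apply: B0P; rewrite /B lt_max ltrDl ltr01 orbT.
exists B; split; first by rewrite /B le_max lexx.
apply/negligibleP; first exact: measurable_norm_gt.
apply: negligibleS measure_support_negligible => x /= Bx /BP.
by rewrite leNgt Bx.
Qed.

Lemma Rintegral_ge0_off_negligible (N : set R) (f : R -> R) :
  measurable N -> mu N = 0%E -> mu.-integrable setT (EFin \o f) ->
  (forall x, ~ N x -> 0 <= f x) -> 0 <= \int[mu]_x f x.
Proof.
move=> mN N0 intf f0; rewrite fine_ge0//.
rewrite (negligible_integral mN _ intf N0)//; apply: integral_ge0 => x [_ Nx].
by rewrite lee_fin; exact: f0.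
Qed.

End compact_support.

(** * The variance bound for Lipschitz linear statistics *)

Section variance_bound.
Context (R : realType) (mu : probability R R).
Hypothesis mu_moments : finite_moments mu.
Variable p : nat -> {poly R}.
Hypothesis p_orthonormal : orthonormal_polynomials mu p.

Lemma lead_coef_ratio_bounded (B : R) n : mu [set x | B < `|x|] = 0%E ->
  lead_coef (p n) / lead_coef (p n.+1) <= B.
Proof.
move=> muB; rewrite -(poly_mean_mulX_lead mu_moments p_orthonormal).
(* By orthonormality the mean of [q] is [B] minus the ratio, so it suffices that [q] is nonnegative
   where |x| <= B. *)
pose q := (B / 2) *: (p n * p n + p n.+1 * p n.+1) + (-1) *: ('X * p n * p n.+1).
have qE : poly_mean mu q = B - poly_mean mu ('X * p n * p n.+1).
  rewrite poly_meanD// !poly_meanZ// poly_meanD// !(poly_mean_orthonormal p_orthonormal).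
  by rewrite !eqxx mulN1r -[true%:R + true%:R]/2%:R divfK ?pnatr_eq0.
rewrite -subr_ge0 -qE /poly_mean.
apply: (Rintegral_ge0_off_negligible _ muB).
- exact: measurable_norm_gt.
- exact: integrable_poly.
move=> x /negP; rewrite -leNgt ler_norml => /andP[Bx xB].
(* Both weights B + x and B - x are nonnegative on this range. *)
have -> : q.[x] = ((B + x) * ((p n).[x] - (p n.+1).[x]) ^+ 2 +
                   (B - x) * ((p n).[x] + (p n.+1).[x]) ^+ 2) / 4.
  by rewrite /q hornerD !hornerZ hornerD !hornerM hornerX; field.
by apply: divr_ge0 => //; apply: addr_ge0; apply: mulr_ge0; rewrite ?sqr_ge0//; lra.
Qed.

Lemma variance_linear_statistic_le (f : R -> R) (L : R) n : 0 <= L ->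
  (forall x y, `|f x - f y| <= L * `|x - y|) -> (0 < n)%N ->
  (variance (ope mu n) (@linear_statistic R f n) <=
   (L ^+ 2 * (lead_coef (p n.-1) / lead_coef (p n)) ^+ 2)%:E)%E.
Proof.
case: n => // n L0 lipf _.
pose m : R := \sum_i moment mu (@orthonormal_fun R p n.+1) f 1 i i.
(* Centering: [m] is tr M for [f], and spreading it over the [n.+1] points makes tr M vanish for
   [g], so that the second moment of its statistic is the dispersion. *)
pose g x := f x - m / n.+1%:R.
have lipg x y : `|g x - g y| <= L * `|x - y|.
  by rewrite /g opprB addrA subrK; exact: lipf.
have domg := poly_dominated_lipschitz lipg.
have domid : poly_dominated (@id R).
  by apply: (@poly_dominated_lipschitz R 1) => x y; rewrite mul1r.
have mf : measurable_fun setT (fun t : n.+1.-tuple R => linear_statistic f t).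
  apply: measurable_sum => i; apply: measurableT_comp (lipschitz_measurable lipf) _.
  exact: measurable_tnth.
have domf := poly_dominated_lipschitz lipf.
have trace0 : \sum_i moment mu (@orthonormal_fun R p n.+1) g 1 i i = 0.
  transitivity (\sum_(i < n.+1)
      (moment mu (@orthonormal_fun R p n.+1) f 1 i i - m / n.+1%:R)).
    apply: eq_bigr => i _.
    (* The unit norm of p_i lets the constant be written as an integral against p_i^2. *)
    have m0 : moment mu (@orthonormal_fun R p n.+1) f 0 i i = 1.
      by rewrite (moment0_orthonormal p_orthonormal) eqxx.
    rewrite -[m / _]mulr1 -[X in _ * X]m0.
    have int0 := integrable_orthonormal_moment mu_moments p 0 i i domf.
    have int1 := integrable_orthonormal_moment mu_moments p 1 i i domf.
    rewrite /moment -RintegralZl// -RintegralB//; last exact: integrable_scale.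
    by apply: eq_Rintegral => x _; rewrite /g !expr1 expr0 mul1r mulrBl.
  by rewrite sumrB sumr_const card_ord -[_ / _ *+ _]mulr_natr divfK ?pnatr_eq0// subrr.
have centered (t : n.+1.-tuple R) : linear_statistic f t - m = linear_statistic g t.
  rewrite /linear_statistic /g sumrB sumr_const card_ord.
  by rewrite -[_ / _ *+ _]mulr_natr divfK// pnatr_eq0.
have /le_trans -> // : (variance (ope mu n.+1) (@linear_statistic R f n.+1) <=
    (dispersion mu p n.+1 g)%:E)%E.
  apply: (variance_le_second_moment (c := m)) => //.
  under eq_integral do rewrite centered.
  rewrite (ope_second_moment mu_moments p_orthonormal _ domg) trace0.
  by rewrite expr0n addr0.
rewrite lee_fin -(dispersion_id mu_moments p_orthonormal).
exact: le_dispersion.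
Qed.

End variance_bound.

Theorem proposition4p4 (R : realType)
    (mu : probability R R)
    (mu_moments : finite_moments mu)
    (mu_support : infinite_set (measure_support mu))
    (p : nat -> {poly R}) (p_orthonormal : orthonormal_polynomials mu p)
    (xstar alpha : R) (alpha_ge0 : 0 <= alpha)
    (f : R -> R) (L : R) (L_ge0 : 0 <= L)
    (f_lipschitz : forall x y : R, `|f x - f y| <= L * `|x - y|) :
  (forall n : nat, (0 < n)%N ->
    (variance (ope mu n) (@scaled_linear_statistic R f alpha xstar n) <=
     (L ^+ 2 * (lead_coef (p n.-1) / lead_coef (p n)) ^+ 2
       * n%:R `^ (2 * alpha))%:E)%E)
  /\ (compact (measure_support mu) ->
      exists C : R, forall n : nat, (0 < n)%N ->
        (variance (ope mu n) (@linear_statistic R f n) <= C%:E)%E).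
Proof.
split=> [n n0|/compact_support_bounded[B [B0 muB]]].
  pose s : R := n%:R `^ alpha.
  have s0 : 0 <= s by exact: powR_ge0.
  (* Translation and scaling are absorbed into the function, whose Lipschitz constant becomes L
     n^alpha. *)
  pose g x := f (s * (x - xstar)).
  have lipg x y : `|g x - g y| <= L * s * `|x - y|.
    apply: (le_trans (f_lipschitz _ _)).
    by rewrite -mulrBr opprB addrA subrK normrM ger0_norm// mulrA.
  have := variance_linear_statistic_le mu_moments p_orthonormal
    (mulr_ge0 L_ge0 s0) lipg n0.
  rewrite exprMn mulrAC mulrC [2 * _]mulrC powRrM powR_mulrn//.
  by rewrite [X in (_ <= X%:E)%E]mulrC.
(* The unscaled bound, with the ratio of leading coefficients replaced by its bound [B]. *)
exists (L ^+ 2 * B ^+ 2) => -[//|n] _.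
apply: (le_trans (variance_linear_statistic_le mu_moments p_orthonormal
  L_ge0 f_lipschitz _)) => //.
have [_ lead_gt0 _] := p_orthonormal.
have ratio_ge0 : 0 <= lead_coef (p n) / lead_coef (p n.+1).
  by rewrite ltW// divr_gt0.
rewrite lee_fin; apply: ler_wpM2l; first exact: sqr_ge0.
apply: lerXn2r; rewrite ?nnegrE//.
exact: (lead_coef_ratio_bounded mu_moments p_orthonormal n muB).
Qed.
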